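(* Let $n\ge 2$ and $m$ be positive integers with $\gcd(m,n!)=1$. Consider an additive cellular automaton $\partial$ of dimension $n-1$ over $\mathbb{Z}/m\mathbb{Z}$ with weight array $W=(w_j)_{j\in[-r,r]^{n-1}}$, and suppose that $\sigma=\sum_{j}w_j$ is invertible modulo $m$. Let $a\in\mathbb{Z}/m\mathbb{Z}$, $d=(d_1,\ldots,d_{n-1})\in(\mathbb{Z}/m\mathbb{Z})^{n-1}$ and $\varepsilon\in\{-1,1\}^{n}$, and put $d_n:=\sigma^{-1}\sum_{k=1}^{n-1}\sigma_kd_k$. Suppose that $d_i$ is invertible in $\mathbb{Z}/m\mathbb{Z}$ for all $1\le i\le n$, and that $\varepsilon_jd_j-\varepsilon_id_i$ is invertible for all $1\le i<j\le n$. Then, in the orbit $\mathcal{O}(\mathrm{AA}(a,d))$, every $n$-simplex with orientation $\varepsilon$ and of size $s$ is balanced, for all positive integers $s\equiv -t \pmod{\mathrm{lcm}(\mathrm{ord}_{m}(\sigma),m)}$ with $t\in[0,n-1]$.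
   Context: For integers $a<b$, $[a,b]=\{a,a+1,\ldots,b\}$. For $n$-tuples $u,v$, $u\cdot v=(u_1v_1,\ldots,u_nv_n)$. An additive cellular automaton (ACA) of dimension $n-1$ over $\mathbb{Z}/m\mathbb{Z}$ with integer weight array $W=(w_j)_{j\in[-r,r]^{n-1}}$ ($r\ge 0$) is the map $\partial$ sending an array $(a_i)_{i\in\mathbb{Z}^{n-1}}$ of elements of $\mathbb{Z}/m\mathbb{Z}$ to $\left(\sum_{j\in[-r,r]^{n-1}}w_ja_{i+j}\right)_{i\in\mathbb{Z}^{n-1}}$. The orbit $\mathcal{O}(A)$ of an array $A$ is the array $(a_{i,j})_{(i,j)\in\mathbb{Z}^{n-1}\times\mathbb{N}}$ whose $j$-th row $(a_{i,j})_{i\in\mathbb{Z}^{n-1}}$ is $\partial^j(A)$. Set $\sigma=\sum_j w_j$ and $\sigma_k=\sum_j j_kw_j$ for $k\in[1,n-1]$. The arithmetic array $\mathrm{AA}(a,d)$, for $a\in\mathbb{Z}/m\mathbb{Z}$ and $d\in(\mathbb{Z}/m\mathbb{Z})^{n-1}$, is $(a+i_1d_1+\cdots+i_{n-1}d_{n-1})_{i\in\mathbb{Z}^{n-1}}$. For an array $(a_i)$ indexed by $\mathbb{Z}^{n-1}\times\mathbb{N}\subset\mathbb{Z}^n$, the $n$-simplex with principal vertex at $j$, orientation $\varepsilon\in\{-1,1\}^n$ and size $s\ge1$ is the multiset $\triangle(j,\varepsilon,s)=\{a_{j+\varepsilon\cdot k}: k\in\mathbb{N}^n,\ k_1+\cdots+k_n\le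 s-1\}$; it appears in the orbit when all these indices lie in $\mathbb{Z}^{n-1}\times\mathbb{N}$. A multiset of elements of $\mathbb{Z}/m\mathbb{Z}$ is balanced if every element of $\mathbb{Z}/m\mathbb{Z}$ occurs in it with the same multiplicity. $\mathrm{ord}_m(\sigma)$ is the multiplicative order of $\sigma$ modulo $m$. *)

(* Defs.v *)
From HB Require Import structures.
From mathcomp Require Import all_boot all_order all_algebra.
From mathcomp Require cyclic.

Set Implicit Arguments.
Unset Strict Implicit.
Unset Printing Implicit Defensive.

Import GRing.Theory.
Local Open Scope ring_scope.

(* The ring Z/mZ for every m > 0, including the zero ring at m = 1, where the
   library's 'Z_1 would be Z/2Z.  (The value at m = 0 is junk.) *)
Definition Zmod (m : nat) : Type := 'I_m.-1.+1.

HB.instance Definition _ (m : nat) := GRing.Zmodule.on (Zmod m).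
HB.instance Definition _ (m : nat) := Finite.on (Zmod m).
HB.instance Definition _ (m : nat) :=
  GRing.Zmodule_isComPzRing.Build (Zmod m)
    (@Zp_mulA _) (@Zp_mulC _) (@Zp_mul1z _) (@Zp_mul_addl _).

(* GRing.unit and _^-1 are only available on nonzero rings. *)
Definition invertible (m : nat) (x : Zmod m) : Prop :=
  exists y : Zmod m, y * x = 1.

Definition Zmod_inv (m : nat) (x : Zmod m) : Zmod m := Zp_inv (x : 'I_m.-1.+1).

Lemma Zmod_mulVx (m : nat) (x : Zmod m) : invertible x -> Zmod_inv x * x = 1.
Proof. by case=> y /Zp_intro_unit; apply: Zp_mulVz. Qed.

(* Least k > 0 with x ^+ k = 1; for invertible x such a k <= m exists. *)
Definition mult_order (m : nat) (x : Zmod m) : nat :=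
  (find (fun k => x ^+ k.+1 == 1) (iota 0 m)).+1.

Lemma val_ZmodX (m : nat) (x : Zmod m) (k : nat) :
  val (x ^+ k) = (val x ^ k %% m.-1.+1)%N.
Proof.
elim: k => [|k IHk] //.
by rewrite exprS expnS -[RHS]modnMmr -IHk.
Qed.

Lemma mult_orderP (m : nat) (x : Zmod m) : (0 < m)%N -> invertible x ->
  x ^+ mult_order x = 1 /\
  forall k, (0 < k)%N -> x ^+ k = 1 -> (mult_order x <= k)%N.
Proof.
move=> m_gt0 [y /Zp_intro_unit co_x].
set p := fun k => x ^+ k.+1 == 1.
have has_p : has p (iota 0 m).
  have t_gt0 : (0 < totient m)%N by rewrite totient_gt0.
  apply/hasP; exists (totient m).-1.
    rewrite mem_iota add0n prednK //= totient_count_coprime.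
    rewrite (@leq_trans (\sum_(0 <= d < m) 1)) ?leq_sum // => [d _|].
      exact: leq_b1.
    by rewrite sum_nat_const_nat subn0 muln1.
  rewrite /p prednK //; apply/eqP/val_inj; rewrite val_ZmodX.
  have /cyclic.Euler_exp_totient : coprime (x : 'I_m.-1.+1) m.-1.+1.
    by rewrite coprime_sym.
  by rewrite [in totient _](prednK m_gt0).
have lt_m : (find p (iota 0 m) < m)%N by rewrite -{2}(size_iota 0 m) -has_find.
split; first by have /eqP := nth_find 0 has_p; rewrite nth_iota.
move=> [//|k] _ xk1; rewrite ltnS leqNgt; apply/negP => lt_k.
have := before_find 0 lt_k; rewrite nth_iota ?(ltn_trans lt_k) // add0n.
by rewrite /p xk1 eqxx.
Qed.

(* Throughout, q = n - 1 is the dimension of the automaton. *)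

Definition box (q r : nat) : finType := {ffun 'I_q -> 'I_r.*2.+1}.

(* Identifies box q r with [-r, r]^q. *)
Definition offset (q r : nat) (j : box q r) : {ffun 'I_q -> int} :=
  [ffun k => (j k)%:Z - r%:Z].

Definition aca (q m r : nat) (W : box q r -> int)
    (A : {ffun 'I_q -> int} -> Zmod m) : {ffun 'I_q -> int} -> Zmod m :=
  fun i => \sum_(j : box q r) (W j)%:~R * A (i + offset j).

Definition aca_orbit (q m r : nat) (W : box q r -> int)
    (A : {ffun 'I_q -> int} -> Zmod m) : {ffun 'I_q -> int} -> nat -> Zmod m :=
  fun i j => iter j (aca W) A i.

Definition weight_sum (q r : nat) (W : box q r -> int) : int :=
  \sum_(j : box q r) W j.

Definition weight_moment (q r : nat) (W : box q r -> int) (k : 'I_q) : int :=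
  \sum_(j : box q r) offset j k * W j.

Definition arith_array (q m : nat) (a : Zmod m) (d : 'I_q -> Zmod m) :
    {ffun 'I_q -> int} -> Zmod m :=
  fun i => a + \sum_(k < q) (i k)%:~R * d k.

(* (d_1, ..., d_{n-1}) completed with d_n. *)
Definition ext_diff (q m r : nat) (W : box q r -> int) (d : 'I_q -> Zmod m) :
    'I_q.+1 -> Zmod m :=
  fun i => if unlift ord_max i is Some k then d k else
    Zmod_inv (weight_sum W)%:~R * \sum_(k < q) (weight_moment W k)%:~R * d k.

(* The k in N^n with k_1 + ... + k_n <= s - 1; when s > 0 all their
   coordinates are < s. *)
Definition simplex_index (n s : nat) : {set {ffun 'I_n -> 'I_s}} :=
  [set k : {ffun 'I_n -> 'I_s} | (\sum_(i < n) k i <= s.-1)%N].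

Definition simplex_point (n s : nat) (j : {ffun 'I_n -> int})
    (eps : 'I_n -> int) (k : {ffun 'I_n -> 'I_s}) : {ffun 'I_n -> int} :=
  [ffun i => j i + eps i * (k i)%:Z].

(* A point of Z^n lies in Z^(n-1) x N when its last coordinate is >= 0. *)
Definition simplex_appears (q : nat) (j : {ffun 'I_q.+1 -> int})
    (eps : 'I_q.+1 -> int) (s : nat) : Prop :=
  forall k, k \in simplex_index q.+1 s -> 0 <= simplex_point j eps k ord_max.

(* Value of an array over Z^(n-1) x N at a point of Z^n; the absolute value is
   harmless on simplices that appear. *)
Definition array_at (q : nat) (T : Type) (b : {ffun 'I_q -> int} -> nat -> T)
    (p : {ffun 'I_q.+1 -> int}) : T :=
  b [ffun k => p (lift ord_max k)] `|p ord_max|%N.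

Definition simplex (q : nat) (T : Type) (b : {ffun 'I_q -> int} -> nat -> T)
    (j : {ffun 'I_q.+1 -> int}) (eps : 'I_q.+1 -> int) (s : nat) : seq T :=
  [seq array_at b (simplex_point j eps k) | k in simplex_index q.+1 s].

Definition balanced (T : finType) (u : seq T) : Prop :=
  forall x y : T, count_mem x u = count_mem y u.

(* Main.v *)
Require Import Defs.
From mathcomp Require Import all_boot all_order all_algebra all_field.
From mathcomp Require Import ring zify.
From mathcomp Require cyclic.

(** The orbit of AA(a, d) is a_(i,j) = sigma^j (a + j d_n + \sum_k i_k d_k), so
a simplex is a multiset of values tau^(k_n) (b + \sum_i e_i k_i) with
tau = sigma^(+-1), and the e_i and their differences invertible.  It is balanced
if its sum against every nontrivial character x |-> w^x of Z/mZ, w in algC,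
vanishes.  For fixed k_n = c, the sum over the other coordinates is a complete
homogeneous symmetric polynomial of degree s - 1 - c in n distinct roots of
unity; its partial fraction expansion extends it to every integer c, with value
0 for s <= c <= s + n - 2, and makes it periodic of period s + t.  The sum over
c < s thus runs over a full period.  If w has order m' then tau^c acts on
w through c mod phi(m'), and shifting c by phi(m') multiplies each partial
fraction by a fixed root of unity, which is not 1 because phi(m') < m'.  Hence
phi(m') times the sum splits into vanishing geometric sums. *)

Set Implicit Arguments.
Unset Strict Implicit.
Unset Printing Implicit Defensive.

Import GRing.Theory Num.Theory.
Local Open Scope ring_scope.

(** * Truncated geometric series and partial fractions *)

Definition geom_poly (R : nzSemiRingType) (s : nat) (x : R) : {poly R} :=
  \poly_(b < s) x ^+ b.

Lemma coef0_geomM (R : nzSemiRingType) (s : nat) (x : R) (p : {poly R}) :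
  (0 < s)%N -> (geom_poly s x * p)`_0 = p`_0.
Proof. by move=> s_gt0; rewrite coefM big_ord1 coef_poly s_gt0 mul1r. Qed.

(** Below degree s, [geom_poly s x] agrees with 1 / (1 - x X), so multiplying the product by 1 - x X
    gives back p. *)
Lemma coefS_geomM (R : nzSemiRingType) (s N : nat) (x : R) (p : {poly R}) :
  (N.+1 < s)%N ->
  (geom_poly s x * p)`_N.+1 = x * (geom_poly s x * p)`_N + p`_N.+1.
Proof.
move=> ltNs; rewrite !coefM big_ord_recl subn0 coef_poly (ltn_trans _ ltNs) //.
rewrite mul1r addrC big_distrr; congr (_ + _); apply: eq_bigr => i _ /=.
have lti : (i.+1 < s)%N by apply: leq_ltn_trans ltNs; apply: ltn_ord.
by rewrite !coef_poly lti (ltnW lti) mulrA -exprS.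
Qed.

(* The coefficients of the partial fraction decomposition
   X^n / \prod_(i <= n) (1 - x_i X) = \sum_(l <= n) pfc x n l / (1 - x_l X). *)
Fixpoint pfc (F : fieldType) (x : nat -> F) (n l : nat) : F :=
  if n is n'.+1 then
    if l == n then - \sum_(i < n) pfc x n' i / (x i - x n)
    else pfc x n' l / (x l - x n)
  else 1.

Section PartialFractions.

Variables (F : fieldType) (x : nat -> F).

(** The numerator X^(n+1) vanishes at X = 0; the last coefficient in [pfc] is chosen to force
    this. *)
Lemma pfc_sum0 (n : nat) : \sum_(l < n.+2) pfc x n.+1 l = 0.
Proof.
rewrite big_ord_recr /= eqxx; apply/eqP; rewrite subr_eq0; apply/eqP.
by apply: eq_bigr => i _; rewrite ltn_eqF.
Qed.

(** Multiplying the expansion of index n + 1 by 1 - x_(n+1) X leaves X times the expansion of index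
    n; compare coefficients of X^(M+1). *)
Lemma pfc_rec (n M : nat) : (forall i, (i < n.+1)%N -> x i != x n.+1) ->
  \sum_(l < n.+2) pfc x n.+1 l * x l ^+ M.+1 =
  x n.+1 * (\sum_(l < n.+2) pfc x n.+1 l * x l ^+ M)
    + \sum_(l < n.+1) pfc x n l * x l ^+ M.
Proof.
move=> x_neq; rewrite big_ord_recr [X in _ = _ * X + _]big_ord_recr /=.
rewrite !eqxx mulrDr addrAC mulrCA -exprS; congr (_ + _).
rewrite big_distrr -big_split; apply: eq_bigr => i _ /=.
rewrite ltn_eqF // exprS; have := x_neq i (ltn_ord i); rewrite -subr_eq0 => xi.
by field.
Qed.


(** The numerator X^n leaves no term of degree below n. *)
Lemma pfc_vanish (n M : nat) :
    (forall i j, (i < j <= n)%N -> x i != x j) -> (M < n)%N ->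
  \sum_(l < n.+1) pfc x n l * x l ^+ M = 0.
Proof.
elim: n M => // n IHn M x_neq.
have x_neqS i j : (i < j <= n)%N -> x i != x j.
  by case/andP=> ij jn; rewrite x_neq // ij leqW.
elim: M => [_|M IHM lt_Mn].
  by rewrite -[RHS](pfc_sum0 n); apply: eq_bigr => l _; rewrite mulr1.
rewrite pfc_rec => [|i lt_in]; last by rewrite x_neq // lt_in leqnn.
by rewrite IHM ?(ltnW lt_Mn) // IHn // mulr0 addr0.
Qed.

(** Both sides obey the same recurrence in N; the shift by n in the exponent is the numerator
    X^n. *)
Lemma coef_prod_geom (n s N : nat) :
    (forall i j, (i < j <= n)%N -> x i != x j) -> (N < s)%N ->
  (\prod_(i < n.+1) geom_poly s (x i))`_N =
  \sum_(l < n.+1) pfc x n l * x l ^+ (N + n).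
Proof.
elim: n N => [|n IHn] N x_neq lt_Ns.
  by rewrite !big_ord1 coef_poly lt_Ns addn0 mul1r.
have x_neqS i j : (i < j <= n)%N -> x i != x j.
  by case/andP=> ij jn; rewrite x_neq // ij leqW.
have x_neqn i : (i < n.+1)%N -> x i != x n.+1.
  by move=> lt_in; rewrite x_neq // lt_in leqnn.
have -> : \prod_(i < n.+2) geom_poly s (x i) =
    geom_poly s (x n.+1) * \prod_(i < n.+1) geom_poly s (x i).
  by rewrite big_ord_recr mulrC.
rewrite addnS pfc_rec //.
elim: N lt_Ns => [|N IHN] lt_Ns.
  rewrite coef0_geomM // IHn // !add0n (pfc_vanish (n := n.+1)) //.
  by rewrite mulr0 add0r.
rewrite coefS_geomM // IHN 1?ltnW // IHn //; congr (_ * _ + _).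
by rewrite addSn -pfc_rec.
Qed.

End PartialFractions.

(** A slack variable with root x_q = 1 turns the simplex inequality into an equality of degree s - 1
    - c. *)
Lemma sum_simplex_slice (R : comNzRingType) (q s c : nat) (x : nat -> R) :
    (c < s)%N -> x q = 1 ->
  \sum_(k in simplex_index q.+1 s | k ord_max == c :> nat)
     \prod_(i < q) x i ^+ k (widen_ord (leqnSn q) i) =
  (\prod_(i < q.+1) geom_poly s (x i))`_(s.-1 - c).
Proof.
move=> lt_cs xq1.
(* The indicator pins the last coordinate to c, and X records \sum_i k_i. *)
pose f (i : 'I_q.+1) (b : 'I_s) : {poly R} :=
  if i == ord_max then (b == c :> nat)%:R *: 'X^b else x i ^+ b *: 'X^b.
have neq_max (i : 'I_q) : (widen_ord (leqnSn q) i == ord_max) = false.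
  by apply/negbTE; rewrite neq_ltn /= ltn_ord.
have fE (k : {ffun 'I_q.+1 -> 'I_s}) : \prod_i f i (k i) =
    ((k ord_max == c :> nat)%:R *
      \prod_(i < q) x i ^+ k (widen_ord (leqnSn q) i)) *: 'X^(\sum_i k i).
  rewrite big_ord_recr /= /f eqxx.
  under eq_bigr => i _ do rewrite neq_max.
  rewrite scaler_prod -scalerAl -scalerAr scalerA mulrC; congr (_ *: _).
  by rewrite prodrXr -exprD [in RHS]big_ord_recr.
have sum_f i : \sum_(b < s) f i b =
    if i == ord_max then 'X^c else geom_poly s (x i).
  rewrite /f; case: eqP => _; last by rewrite /geom_poly poly_def.
  rewrite (bigD1 (Ordinal lt_cs)) //= eqxx scale1r big1 ?addr0 // => b neq_b.
  by rewrite (_ : (_ == _) = false) ?scale0r //; apply/negbTE.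
(* At degree s - 1, the factor [geom_poly s 1] adds up all coefficients of degree at most s - 1; it
   is also the factor of x_q. *)
have <- : (geom_poly s 1 * \prod_i \sum_(b < s) f i b)`_s.-1 =
    (\prod_(i < q.+1) geom_poly s (x i))`_(s.-1 - c).
  under eq_bigr => i _ do rewrite sum_f.
  rewrite [in LHS]big_ord_recr [in RHS]big_ord_recr /= eqxx.
  rewrite mulrA coefMXn ltnNge -ltnS (ltn_predK lt_cs) lt_cs /= mulrC xq1.
  congr (polyseq (_ * _))`_(_); apply: eq_bigr => i _.
  by rewrite neq_max.
rewrite bigA_distr_bigA mulr_sumr coef_sum [in LHS]big_mkcond /=.
apply: eq_bigr => k _; rewrite fE -scalerAr coefZ coefMXn inE ltnNge.
case: leqP => [le_k|_]; last by rewrite mulr0.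
rewrite coef_poly expr1n.
rewrite -[X in (_ < X)%N](ltn_predK lt_cs) ltnS leq_subr.
by rewrite mulr1 mulr_natl mulrb.
Qed.

(** * Characters of Z/mZ *)

Definition zchar (m : nat) (w : algC) (x : Zmod m) : algC :=
  w ^+ (x : 'I_m.-1.+1).

Section Characters.

Variables (m : nat) (w : algC).
Hypothesis w_root : w ^+ m.-1.+1 = 1.

Implicit Types x y : Zmod m.

Lemma zcharD x y : zchar w (x + y) = zchar w x * zchar w y.
Proof. by rewrite /zchar expr_mod // exprD. Qed.

(** Lets a multiplier such as tau^c be absorbed into the root of unity. *)
Lemma zcharM x y : zchar w (x * y) = zchar (zchar w x) y.
Proof. by rewrite /zchar expr_mod // exprM. Qed.

Lemma zchar1 : zchar w (1 : Zmod m) = w.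
Proof. by rewrite /zchar expr_mod // expr1. Qed.

Lemma zcharMn x n : zchar w (x *+ n) = zchar w x ^+ n.
Proof. by elim: n => // n IHn; rewrite mulrS zcharD IHn exprS. Qed.

Lemma zchar_sum (I : finType) (f : I -> Zmod m) :
  zchar w (\sum_i f i) = \prod_i zchar w (f i).
Proof. exact: (big_morph _ zcharD (erefl : zchar w 0 = 1)). Qed.

Lemma zchar_root x : zchar w x ^+ m.-1.+1 = 1.
Proof. by rewrite /zchar exprAC w_root expr1n. Qed.

(** An invertible x generates the additive group. *)
Lemma zchar_unit x : invertible x -> zchar w x = 1 -> w = 1.
Proof.
by case=> y yx1 wx1; rewrite -zchar1 -yx1 mulrC zcharM wx1 /zchar expr1n.
Qed.

End Characters.

(** * Units, the totient and rearranged sums *)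

Lemma invertibleM (m : nat) (x y : Zmod m) :
  invertible x -> invertible y -> invertible (x * y).
Proof.
by case=> x' x'x [y' y'y]; exists (x' * y'); rewrite mulrACA x'x y'y mulr1.
Qed.

Lemma invertibleX (m : nat) (x : Zmod m) (n : nat) :
  invertible x -> invertible (x ^+ n).
Proof.
by case=> y yx; exists (y ^+ n); rewrite -exprMn yx expr1n.
Qed.

Lemma invertibleN (m : nat) (x : Zmod m) : invertible x -> invertible (- x).
Proof. by case=> y yx; exists (- y); rewrite mulrNN. Qed.

Lemma ltn_totient (n : nat) : (1 < n)%N -> (totient n < n)%N.
Proof.
case: n => // n n_gt1; rewrite totient_count_coprime big_nat_recl // ltnS.
rewrite /coprime gcdn0 gtn_eqF // add0n (@leq_trans (\sum_(0 <= i < n) 1)) //.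
  by apply: leq_sum => i _; apply: leq_b1.
by rewrite sum_nat_const_nat subn0 muln1.
Qed.

Lemma sum_nat_mul_shift (V : nmodType) (n k : nat) (f : nat -> V) :
  \sum_(0 <= i < n * k) f i =
  \sum_(0 <= u < n) \sum_(0 <= j < k) f (j + u * k)%N.
Proof.
rewrite big_nat_mul; apply: eq_bigr => u _.
by rewrite -{1}[(u * k)%N]add0n big_addn mulSn addnK.
Qed.

Lemma sum_unity_root (F : fieldType) (rho : F) (n : nat) :
  rho != 1 -> rho ^+ n = 1 -> \sum_(0 <= u < n) rho ^+ u = 0.
Proof.
move=> rho1 rhon; rewrite big_mkord; apply/eqP.
have /eqP := subrX1 rho n; rewrite rhon subrr eq_sym mulf_eq0 subr_eq0.
by rewrite (negbTE rho1).
Qed.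

(** * Vanishing of the character sum over a simplex *)

Section CharacterSum.

Variables (q m s t : nat) (w : algC) (b tau : Zmod m) (e : 'I_q.+1 -> Zmod m).
Hypotheses (w_root : w ^+ m.-1.+1 = 1) (w_neq1 : w != 1).
Hypotheses (tau_inv : invertible tau) (tau_root : tau ^+ (s + t) = 1).
Hypotheses (s_gt0 : (0 < s)%N) (le_tq : (t <= q)%N).
Hypothesis st0 : (s + t)%:R = 0 :> Zmod m.
Hypothesis e_inv : forall i, invertible (e i).
Hypothesis e_diff : forall i j : 'I_q.+1, (i < j)%N -> invertible (e j - e i).

(* The last slot carries the slack variable s - 1 - \sum_i k_i, whose
   difference is 0. *)
Let E (l : nat) : Zmod m := if (l < q)%N then e (inord l) else 0.

Let z (c : nat) : algC := zchar w (tau ^+ c).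

Let x (y : algC) (l : nat) : algC := zchar y (E l).

(** The l-th partial fraction term at level k_n = c. Its exponent (s - 1 - c) + q is taken in Z/mZ,
    so that it makes sense for every c. *)
Let slice (c l : nat) : algC := pfc (x (z c)) q l *
  zchar (z c) (b + e ord_max *+ c + E l * ((s + q).-1%:R - c%:R)).

Let z_root c : z c ^+ m.-1.+1 = 1.
Proof. exact: zchar_root. Qed.

Let z_neq1 c : z c != 1.
Proof.
by apply: contra_neq w_neq1; apply: zchar_unit => //; apply: invertibleX.
Qed.

Let E_diff i j : (i < j <= q)%N -> invertible (E i - E j).
Proof.
case/andP=> lt_ij le_jq; have lt_iq := leq_trans lt_ij le_jq.
rewrite /E lt_iq; case: ltnP => [lt_jq|_]; last by rewrite subr0.
rewrite -opprB; apply: invertibleN; apply: e_diff.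
by rewrite !inordK // ltnS ltnW.
Qed.

Let last_diff l : invertible (e ord_max - E l).
Proof.
rewrite /E; case: ifP => [lt_lq|_]; last by rewrite subr0.
by apply: e_diff; rewrite inordK // ltnS ltnW.
Qed.

Let x_neq c i j : (i < j <= q)%N -> x (z c) i != x (z c) j.
Proof.
move=> lt_ij; apply: contra_neq (z_neq1 c) => xij.
have xj_neq0 : x (z c) j != 0.
  have := zchar_root (z_root c) (E j); rewrite -/(x _ _) exprS.
  by apply: contra_eq_neq => ->; rewrite mul0r eq_sym oner_neq0.
apply: (zchar_unit (z_root c) (E_diff lt_ij)).
apply: (mulIf xj_neq0); rewrite mul1r -{2}xij /x.
by rewrite -zcharD // subrK.
Qed.

Let slice_power c l : (c < s + q)%N ->
  slice c l = zchar (z c) (b + e ord_max *+ c) *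
    (pfc (x (z c)) q l * x (z c) l ^+ ((s + q).-1 - c)).
Proof.
move=> lt_c; rewrite /slice zcharD // mulrCA -natrB; last first.
  by rewrite -ltnS (ltn_predK lt_c).
by rewrite mulr_natr zcharMn.
Qed.

Let slice_sum c : (c < s)%N ->
  \sum_(k in simplex_index q.+1 s | k ord_max == c :> nat)
     zchar w (tau ^+ k ord_max * (b + \sum_i e i *+ k i)) =
  \sum_(l < q.+1) slice c l.
Proof.
move=> lt_cs; have lt_csq : (c < s + q)%N by rewrite ltn_addr.
under [RHS]eq_bigr => l _ do rewrite slice_power //.
have -> : ((s + q).-1 - c = s.-1 - c + q)%N by lia.
rewrite -mulr_sumr -(@coef_prod_geom _ _ _ s); first last.
- by lia.
- exact: x_neq.
rewrite -sum_simplex_slice //; last by rewrite /x /E ltnn.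
rewrite mulr_sumr; apply: eq_bigr => k /andP[_ /eqP kc].
rewrite kc zcharM // -/(z c) big_ord_recr /= kc.
rewrite (addrC (\sum_(i < q) _)) addrA [LHS]zcharD // zchar_sum //.
congr (_ * _); apply: eq_bigr => i _; rewrite zcharMn // /x /E ltn_ord.
by congr (zchar _ (e _) ^+ _); apply: val_inj; rewrite /= inordK // ltnS ltnW.
Qed.

(** Here the exponent s + q - 1 - c lies in [0, q - 1], below the degree q of the numerator; t <= q
    keeps it nonnegative. *)
Let slice_vanish c : (s <= c < s + t)%N -> \sum_(l < q.+1) slice c l = 0.
Proof.
case/andP=> le_sc lt_c; have lt_csq : (c < s + q)%N.
  by apply: leq_trans lt_c _; rewrite leq_add2l.
under eq_bigr => l _ do rewrite slice_power //.
rewrite -mulr_sumr pfc_vanish ?mulr0 //; first exact: x_neq.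
rewrite ltn_subLR; last by rewrite -ltnS (ltn_predK lt_csq).
by rewrite -ltnS (ltn_predK lt_csq) ltnS leq_add2r.
Qed.

Let slice_period c l u : slice (c + u * (s + t)) l = slice c l.
Proof.
have zE : z (c + u * (s + t)) = z c.
  by rewrite /z exprD mulnC exprM tau_root expr1n mulr1.
have stM : (u * (s + t))%:R = 0 :> Zmod m by rewrite natrM st0 mulr0.
rewrite /slice zE; congr (_ * zchar _ _).
by rewrite mulrnDr -(mulr_natr _ (u * _)) natrD stM mulr0 !addr0.
Qed.

Lemma simplex_zchar_sum :
  \sum_(k in simplex_index q.+1 s)
     zchar w (tau ^+ k ord_max * (b + \sum_i e i *+ k i)) = 0.
Proof.
rewrite (partition_big (fun k : {ffun 'I_q.+1 -> 'I_s} => k ord_max) predT) //=.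
under eq_bigr => c _ do rewrite (slice_sum (ltn_ord c)).
rewrite -(big_mkord predT (fun c => \sum_(l < q.+1) slice c l)).
have -> : \sum_(0 <= c < s) \sum_(l < q.+1) slice c l =
          \sum_(0 <= c < s + t) \sum_(l < q.+1) slice c l.
  rewrite [RHS](@big_cat_nat _ _ _ s) ?leq_addr //=.
  rewrite [X in _ = _ + X]big_nat_cond [X in _ = _ + X]big1 ?addr0 //.
  by move=> c /andP[/slice_vanish].
have [m' w_prim m'_dvd] := prim_order_exists (ltn0Sn m.-1) w_root.
have m'_gt1 : (1 < m')%N.
  rewrite ltn_neqAle (prim_order_gt0 w_prim) andbT.
  apply: contra_neq w_neq1 => m'1.
  by have := prim_expr_order w_prim; rewrite -m'1 expr1.
pose phi := totient m'.
have phi_gt0 : (0 < phi)%N by rewrite totient_gt0 ltnW.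
(* The exponent phi is a period of z but phi < m', so that moving c by phi
   multiplies each term by a nontrivial root of unity. *)
have zchar_tau_phi : zchar w (tau ^+ phi) = w.
  rewrite /zchar val_ZmodX expr_mod // -(prim_expr_mod w_prim).
  rewrite cyclic.Euler_exp_totient ?(prim_expr_mod w_prim) //.
  (* tau is a unit modulo m, hence modulo its divisor m'. *)
  rewrite coprime_sym; apply: coprime_dvdl m'_dvd _.
  by have [y yx] := tau_inv; apply: Zp_intro_unit yx.
have z_phi c u : z (c + u * phi) = z c.
  elim: u => [|u IHu]; first by rewrite addn0.
  by rewrite mulSn addnCA /z exprD zcharM // zchar_tau_phi.
(* Moving c by phi adds phi e_n to the exponent and removes phi E_l from it. *)
pose rho c l := zchar (z c) ((e ord_max - E l) *+ phi).
have slice_phi c l u : slice (c + u * phi) l = slice c l * rho c l ^+ u.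
  rewrite /slice z_phi /rho -zcharMn // -mulrA -zcharD //.
  congr (_ * zchar _ _).
  by rewrite -mulrnA (mulnC phi) -(mulr_natr _ (u * phi)) mulrnDr natrD
       -(mulr_natr _ (u * phi)); ring.
have rho_neq1 c l : rho c l != 1.
  have phi_neq1 : w ^+ phi != 1.
    rewrite -(prim_order_dvd w_prim); apply/negP => /(dvdn_leq phi_gt0).
    by rewrite leqNgt ltn_totient.
  apply: contra_neq phi_neq1.
  (* Cancelling the unit tau^c (e_n - E_l) from [rho c l = 1] leaves w^phi = 1. *)
  rewrite /rho zcharMn // /z -zcharM // -zcharMn //.
  rewrite -mulr_natl zcharM // => /zchar_unit zchar_phi.
  rewrite -[in LHS](zchar1 w_root) -zcharMn // zchar_phi //.
    exact: zchar_root.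
  by apply: invertibleM => //; apply: invertibleX.
have rho_root c l : rho c l ^+ (s + t) = 1.
  by rewrite /rho -zcharMn // -mulr_natr st0 mulr0.
have : (\sum_(0 <= c < s + t) \sum_(l < q.+1) slice c l) *+ phi = 0.
  transitivity (\sum_(0 <= c < phi * (s + t)) \sum_(l < q.+1) slice c l).
    rewrite sum_nat_mul_shift -[in LHS](subn0 phi) -sumr_const_nat.
    apply: eq_bigr => u _; apply: eq_bigr => c _; apply: eq_bigr => l _.
    by rewrite slice_period.
  (* The phi periods are regrouped into phi progressions of step phi and length s + t. *)
  rewrite mulnC sum_nat_mul_shift exchange_big big1 // => c _ /=.
  rewrite exchange_big big1 // => l _ /=.
  under eq_bigr => u _ do rewrite slice_phi.
  by rewrite -mulr_sumr sum_unity_root ?mulr0.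
by move/eqP; rewrite mulrn_eq0 gtn_eqF //= => /eqP.
Qed.

End CharacterSum.

(** * From characters to balanced multisets *)

Lemma prim_zchar_eq1 (m : nat) (z : algC) (x : Zmod m) :
  m.-1.+1.-primitive_root z -> zchar z x = 1 -> x = 0.
Proof.
move=> z_prim /eqP; rewrite -(prim_order_dvd z_prim) => /dvdnP[k xE].
apply: val_inj; have := ltn_ord (x : 'I_m.-1.+1); rewrite /= xE.
by case: k {xE} => // k; rewrite mulSn ltnNge leq_addr.
Qed.

(** Fourier inversion: summing over the characters of v - x detects v = x, and only the trivial
    character survives the sum over u, so every multiplicity is the size of u over the order of the
    group. *)
Lemma balanced_zchar (m : nat) (u : seq (Zmod m)) :
    (forall w : algC, w ^+ m.-1.+1 = 1 -> w != 1 ->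
       \sum_(v <- u) zchar w v = 0) ->
  balanced u.
Proof.
move=> u_sum0; have [z z_prim] := C_prim_root_exists (ltn0Sn m.-1).
have z_root := prim_expr_order z_prim.
have count_size x : (count_mem x u)%:R * m.-1.+1%:R = (size u)%:R :> algC.
  transitivity (\sum_(v <- u) \sum_(0 <= k < m.-1.+1) zchar (z ^+ k) (v - x)).
    rewrite -sum1_count natr_sum mulr_suml big_mkcond /=.
    apply: eq_bigr => v _.
    have zcharX k : zchar (z ^+ k) (v - x) = zchar z (v - x) ^+ k.
      by rewrite /zchar exprAC.
    under eq_bigr => k _ do rewrite zcharX.
    case: eqP => [->|/eqP neq_vx].
      under eq_bigr => k _ do rewrite subrr expr1n.
      by rewrite mul1r sumr_const_nat subn0.
    rewrite sum_unity_root ?zchar_root //; apply: contra neq_vx => /eqP.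
    by move/(prim_zchar_eq1 z_prim)/eqP; rewrite subr_eq0.
  rewrite exchange_big big_nat_recl //= [X in _ + X]big_nat_cond.
  rewrite [X in _ + X]big1 ?addr0 => [|k /andP[/andP[_ lt_k] _]].
    under eq_bigr => v _ do rewrite /zchar expr0 expr1n.
    by rewrite big_const_seq count_predT iter_addr_0.
  have zk_root : (z ^+ k.+1) ^+ m.-1.+1 = 1 by rewrite exprAC z_root expr1n.
  under eq_bigr => v _ do rewrite zcharD //.
  rewrite -mulr_suml u_sum0 ?mul0r //.
  rewrite -(prim_order_dvd z_prim); apply/negP => /(dvdn_leq (ltn0Sn k)).
  by rewrite ltnS leqNgt lt_k.
move=> x y; apply/eqP; rewrite -(eqr_nat algC); apply/eqP.
by apply: (@mulIf _ m.-1.+1%:R); rewrite ?pnatr_eq0 // !count_size.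
Qed.

Lemma balanced_geometric_simplex (q m s t : nat) (b tau : Zmod m)
    (e : 'I_q.+1 -> Zmod m) :
    invertible tau -> tau ^+ (s + t) = 1 -> (s + t)%:R = 0 :> Zmod m ->
    (0 < s)%N -> (t <= q)%N -> (forall i, invertible (e i)) ->
    (forall i j : 'I_q.+1, (i < j)%N -> invertible (e j - e i)) ->
  balanced [seq tau ^+ k ord_max * (b + \sum_i e i *+ k i) |
             k : {ffun 'I_q.+1 -> 'I_s} in simplex_index q.+1 s].
Proof.
move=> tau_inv tau_root st0 s_gt0 le_tq e_inv e_diff.
apply: balanced_zchar => w w_root w_neq1; rewrite big_image.
exact: (simplex_zchar_sum b w_root w_neq1 tau_inv tau_root s_gt0 le_tq).
Qed.

(** * Simplices in the orbit of an arithmetic array *)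

Lemma val_Zmod_nat (m n : nat) : val (n%:R : Zmod m) = (n %% m.-1.+1)%N.
Proof.
elim: n => [|n IHn]; first by rewrite mod0n.
by rewrite mulrS -[in RHS](add1n n) -modnDmr -IHn /= modnDml.
Qed.

(** As \sum_k sigma_k d_k = sigma d_n, one step adds d_n to the array and then scales it by
    sigma. *)
Lemma aca_orbit_arith (q m r : nat) (W : box q r -> int) (a dn : Zmod m)
    (d : 'I_q -> Zmod m) (i : {ffun 'I_q -> int}) (n : nat) :
    (weight_sum W)%:~R * dn = \sum_(k < q) (weight_moment W k)%:~R * d k ->
  aca_orbit W (arith_array a d) i n =
  (weight_sum W)%:~R ^+ n * (a + dn *+ n + \sum_(k < q) (i k)%:~R * d k).
Proof.
move=> dnE; rewrite /aca_orbit; elim: n i => [|n IHn] i.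
  by rewrite mul1r addr0.
rewrite iterS /aca; under eq_bigr => j _ do rewrite IHn mulrCA.
rewrite -mulr_sumr exprSr -mulrA; congr (_ * _).
have -> : a + dn *+ n.+1 + \sum_(k < q) (i k)%:~R * d k =
    (a + dn *+ n + \sum_(k < q) (i k)%:~R * d k) + dn.
  by rewrite mulrSr; ring.
rewrite mulrDr dnE /weight_sum rmorph_sum /= mulr_suml.
have -> : \sum_(k < q) (weight_moment W k)%:~R * d k =
    \sum_(j : box q r) (W j)%:~R * \sum_(k < q) (offset j k)%:~R * d k.
  under [RHS]eq_bigr => j _ do rewrite mulr_sumr.
  rewrite exchange_big; apply: eq_bigr => k _ /=.
  rewrite /weight_moment rmorph_sum mulr_suml /=; apply: eq_bigr => j _.
  by rewrite intrM; ring.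
rewrite -big_split; apply: eq_bigr => j _ /=; rewrite -mulrDr -!addrA.
congr (_ * (_ + (_ + _))); rewrite -big_split; apply: eq_bigr => k _ /=.
by rewrite ffunE intrD mulrDl.
Qed.

Theorem theorem1p14 (q m r : nat) (hn : (2 <= q.+1)%N) (hm : (0 < m)%N)
    (hcop : coprime m (q.+1)`!) (W : box q r -> int)
    (hsigma : invertible ((weight_sum W)%:~R : Zmod m))
    (a : Zmod m) (d : 'I_q -> Zmod m) (eps : 'I_q.+1 -> int)
    (heps : forall i, eps i = -1 \/ eps i = 1)
    (hd : forall i : 'I_q.+1, invertible (ext_diff W d i))
    (hdd : forall i j : 'I_q.+1, (i < j)%N ->
       invertible ((eps j)%:~R * ext_diff W d j - (eps i)%:~R * ext_diff W d i))
    (s t : nat) (hs : (0 < s)%N) (ht : (t <= q.+1 - 1)%N)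
    (hst : (s%:Z = - t%:Z
       %[mod (lcmn (mult_order ((weight_sum W)%:~R : Zmod m)) m)%:Z])%Z)
    (j : {ffun 'I_q.+1 -> int}) :
  simplex_appears j eps s ->
  balanced (simplex (aca_orbit W (arith_array a d)) j eps s).
Proof.
move=> appears; set sigma : Zmod m := (weight_sum W)%:~R.
pose D := ext_diff W d; pose J := `|j ord_max|%N.
have dvd_st : (lcmn (mult_order sigma) m %| s + t)%N.
  move/eqP: hst; rewrite eqz_mod_dvd opprK /=; exact.
have sigma_root : sigma ^+ (s + t) = 1.
  have /dvdnP[k ->] := dvdn_trans (dvdn_lcml _ _) dvd_st.
  by rewrite mulnC exprM (mult_orderP hm hsigma).1 expr1n.
have st0 : (s + t)%:R = 0 :> Zmod m.
  apply: val_inj; rewrite val_Zmod_nat /= prednK //; apply/eqP.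
  exact: dvdn_trans (dvdn_lcmr _ _) dvd_st.
have sigmaV : Zmod_inv sigma * sigma = 1 by apply: Zmod_mulVx.
have D_max : sigma * D ord_max = \sum_(k < q) (weight_moment W k)%:~R * d k.
  by rewrite /D /ext_diff unlift_none mulrA (mulrC sigma) sigmaV mul1r.
have D_lift k : D (lift ord_max k) = d k by rewrite /D /ext_diff liftK.
have eps_inv i : invertible ((eps i)%:~R : Zmod m).
  by exists (eps i)%:~R; rewrite -intrM; case: (heps i) => ->.
(* This is sigma^(eps_n), the scaling per step along the last axis. *)
pose tau := if eps ord_max == 1 then sigma else Zmod_inv sigma.
have sigmaV_inv : invertible (Zmod_inv sigma) by exists sigma; rewrite mulrC.
have tau_inv : invertible tau by rewrite /tau; case: ifP.
have tau_root : tau ^+ (s + t) = 1.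
  rewrite /tau; case: ifP => // _.
  by rewrite -[LHS]mulr1 -[X in _ * X = _]sigma_root -exprMn sigmaV expr1n.
pose e i := sigma ^+ J * ((eps i)%:~R * D i).
pose b := sigma ^+ J * (a + \sum_i (j i)%:~R * D i).
have point_value (k : {ffun 'I_q.+1 -> 'I_s}) : k \in simplex_index q.+1 s ->
    array_at (aca_orbit W (arith_array a d)) (simplex_point j eps k) =
    tau ^+ k ord_max * (b + \sum_i e i *+ k i).
  move=> k_in; rewrite /array_at (aca_orbit_arith _ _ _ D_max).
  have p_ge0 := appears k k_in; set p := simplex_point j eps k in p_ge0 *.
  (* Since p_n >= 0, time joins the sum as an n-th coordinate with difference d_n. *)
  transitivity (sigma ^+ `|p ord_max| * (a + \sum_i (p i)%:~R * D i)).
    congr (_ * _); rewrite [in RHS](bigD1_ord ord_max) //= -addrA.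
    congr (_ + (_ + _)).
      by rewrite -mulr_natl -{2}(gez0_abs p_ge0).
    by apply: eq_bigr => i _; rewrite D_lift ffunE.
  have -> : sigma ^+ `|p ord_max| = tau ^+ k ord_max * sigma ^+ J.
    rewrite /tau /J; move: p_ge0; rewrite ffunE.
    case: (heps ord_max) => ->.
      move=> kj.
      have -> : `|j ord_max|%N =
          (k ord_max + `|(j ord_max + -1 * (k ord_max)%:Z)%R|)%N.
        by lia.
      by rewrite exprD mulrA -exprMn sigmaV expr1n mul1r.
    move=> _; rewrite eqxx -exprD; congr (_ ^+ _).
    (* The principal vertex k = 0 lies in the simplex, so j_n >= 0. *)
    have /appears : [ffun => Ordinal hs] \in simplex_index q.+1 s.
      by rewrite inE big1 // => i _; rewrite ffunE.
    by rewrite !ffunE /=; lia.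
  rewrite -mulrA; congr (_ * _); rewrite /b mulrDr [in RHS]mulrDr -addrA.
  congr (_ + _); rewrite !mulr_sumr -big_split; apply: eq_bigr => i _ /=.
  rewrite /e ffunE intrD intrM -mulr_natr; ring.
have -> : simplex (aca_orbit W (arith_array a d)) j eps s =
    [seq tau ^+ k ord_max * (b + \sum_i e i *+ k i) |
      k : {ffun 'I_q.+1 -> 'I_s} in simplex_index q.+1 s].
  by apply/eq_in_map => k; rewrite mem_enum => /point_value.
apply: (balanced_geometric_simplex b tau_inv tau_root st0 hs).
- by move: ht; rewrite subn1.
- by move=> i; do 2?apply: invertibleM => //; apply: invertibleX.
- move=> i i' lt_i; rewrite /e -mulrBr; apply: invertibleM; last exact: hdd.
  exact: invertibleX.
Qed.
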